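(* Let $p\in(1,\infty)$ and $0\le \mathfrak p\le \mathfrak q<\infty$. Let $\mathfrak a:Q_1\to\mathbb R$ satisfy $0<\inf_{Q_1}\mathfrak a\le \sup_{Q_1}\mathfrak a<\infty$, be continuously differentiable in $x$ and in $t$ on $Q_1$, and satisfy $\|D_{x,t}\mathfrak a\|_{L^\infty(Q_1)}<\infty$. Let $f\in L^\infty(Q_1)\cap C^0(Q_1)$ with $\sup_{Q_1}f\le\mathfrak c_0$ for some negative constant $\mathfrak c_0$. Let $u\in C^0(Q_1)$ be a viscosity solution of $$\partial_t u=\big(|\nabla u|^{\mathfrak p}+\mathfrak a(x,t)|\nabla u|^{\mathfrak q}\big)\Delta_p^{\mathrm N}u+f(x,t)\quad\text{in }Q_1,$$ and let $\theta=\frac{2+\mathfrak p}{1+\mathfrak p}$. Then there is a constant $C_\sharp=C_\sharp(n,p,\mathfrak p,\mathfrak q,\|\mathfrak a\|_{L^\infty(Q_1)},\mathfrak c_0)>0$ such that for every local extremum point $(x_0,t_0)\in Q_1$ of $u$ and every $r>0$ with $Q_{r,\theta}(x_0,t_0)\subset Q_1$, $$\sup_{\partial_{\rm par}Q_{r,\theta}(x_0,t_0)}\big(u(x,t)-u(x_0,t_0)\big)\ge C_\sharp\, r^{1+\frac1{1+\mathfrak p}} .$$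
   Context: Notation: $B_r(x_0)=\{x\in\mathbb R^n:|x-x_0|<r\}$, $Q_r=B_r(0)\times(-r^2,0]$, $Q_{r,\theta}(x_0,t_0)=B_r(x_0)\times(t_0-r^\theta,t_0]$, with parabolic boundary $\partial_{\rm par}Q_{r,\theta}(x_0,t_0)=\big(\partial B_r(x_0)\times[t_0-r^\theta,t_0)\big)\cup\big(B_r(x_0)\times\{t_0-r^\theta\}\big)$; $\nabla$ and $D^2$ are taken in $x$ only, $D_{x,t}$ is the full space-time gradient. The normalized $p$-Laplacian is $\Delta_p^{\mathrm N}u=\Delta u+(p-2)\left\langle D^2u\frac{\nabla u}{|\nabla u|},\frac{\nabla u}{|\nabla u|}\right\rangle$, and $\mathcal H(x,t,\xi)=|\xi|^{\mathfrak p}+\mathfrak a(x,t)|\xi|^{\mathfrak q}$. Viscosity solutions of $\partial_tu-\mathcal H(x,t,\nabla u)\Delta_p^{\mathrm N}u=f$ in $Q_1$: a locally bounded upper semicontinuous $u$ is a viscosity subsolution if at each $(x_0,t_0)\in Q_1$: (1) for every $\phi\in C^{2,1}(Q_1)$ such that $u-\phi$ has a local maximum at $(x_0,t_0)$ and $\nabla\phi(x_0,t_0)\ne0$, one has $\partial_t\phi(x_0,t_0)-\mathcal H(x_0,t_0,\nabla\phi(x_0,t_0))\Delta_p^{\mathrm N}\phi(x_0,t_0)\le f(x_0,t_0)$; and/or (2) if there are $\delta_1>0$ and $\phi\in C^1((t_0-\delta_1,t_0+\delta_1))$ with $\phi(t_0)=0$, $u(x_0,t_0)\ge u(x_0,t)-\phi(t)$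 for all $t\in(t_0-\delta_1,t_0+\delta_1)$, and $x\mapsto\sup_{t\in(t_0-\delta_1,t_0+\delta_1)}(u(x,t)-\phi(t))$ constant in a neighborhood of $x_0$, then $\phi'(t_0)\le f(x_0,t_0)$. Here (1) treats test functions with nonvanishing gradient and (2) the degenerate case. A locally bounded lower semicontinuous $u$ is a viscosity supersolution if the same holds with maximum replaced by minimum, $\sup$ by $\inf$, and all of the inequalities reversed. A continuous function is a viscosity solution if it is both a sub- and a supersolution. *)

(* Defs.v *)
From HB Require Import structures.
From mathcomp Require Import all_boot all_order all_algebra.
From mathcomp Require Import all_classical all_reals all_analysis.

Set Implicit Arguments.
Unset Strict Implicit.
Unset Printing Implicit Defensive.

Import Order.TTheory GRing.Theory Num.Theory.
Import numFieldNormedType.Exports.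

Local Open Scope classical_set_scope.
Local Open Scope ring_scope.

(* The library norm on 'rV[R]_n is the max norm; balls and gradients need the
   Euclidean one. *)
Definition dotr (R : realType) (n : nat) (x y : 'rV[R]_n) : R :=
  \sum_(i < n) x ord0 i * y ord0 i.

Definition enorm (R : realType) (n : nat) (x : 'rV[R]_n) : R :=
  Num.sqrt (dotr x x).

Definition eball (R : realType) (n : nat) (r : R) (x0 : 'rV[R]_n) :
    set 'rV[R]_n :=
  [set x | enorm (x - x0) < r].

Definition esphere (R : realType) (n : nat) (r : R) (x0 : 'rV[R]_n) :
    set 'rV[R]_n :=
  [set x | enorm (x - x0) = r].

Definition Q (R : realType) (n : nat) (r : R) : set ('rV[R]_n * R) :=
  eball r 0 `*` [set t | - r ^+ 2 < t <= 0].

Definition Qtheta (R : realType) (n : nat) (r theta : R) (z0 : 'rV[R]_n * R) :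
    set ('rV[R]_n * R) :=
  eball r z0.1 `*` [set t | z0.2 - r `^ theta < t <= z0.2].

Definition par_boundary (R : realType) (n : nat) (r theta : R)
    (z0 : 'rV[R]_n * R) : set ('rV[R]_n * R) :=
  (esphere r z0.1 `*` [set t | z0.2 - r `^ theta <= t < z0.2]) `|`
  (eball r z0.1 `*` [set z0.2 - r `^ theta]).

Definition Linfty_norm (R : realType) (T : Type) (D : set T) (g : T -> R) :
    \bar R :=
  ereal_sup [set `|g z|%:E | z in D].

Definition grad (R : realType) (n : nat) (g : 'rV[R]_n * R -> R)
    (z : 'rV[R]_n * R) : 'rV[R]_n :=
  \row_i 'D_(delta_mx 0 i) (fun x => g (x, z.2)) z.1.

Definition hess (R : realType) (n : nat) (g : 'rV[R]_n * R -> R)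
    (z : 'rV[R]_n * R) : 'M[R]_n :=
  \matrix_(i, j)
    'D_(delta_mx 0 j) (fun x => grad g (x, z.2) ord0 i) z.1.

(* Difference quotients in t are restricted to the domain Q 1, which contains
   the time slice t = 0: there the time derivative is the left one, elsewhere
   it is the usual one. *)
Definition tquot (R : realType) (n : nat) (g : 'rV[R]_n * R -> R)
    (z : 'rV[R]_n * R) (s : R) : R :=
  (s - z.2)^-1 * (g (z.1, s) - g z).

Definition tfilter (R : realType) (n : nat) (z : 'rV[R]_n * R) : set_system R :=
  within [set s | Q 1 (z.1, s)] (z.2)^'.

Definition tderivable (R : realType) (n : nat) (g : 'rV[R]_n * R -> R)
    (z : 'rV[R]_n * R) : Prop :=
  cvg (tquot g z @ tfilter z).

Definition tderiv (R : realType) (n : nat) (g : 'rV[R]_n * R -> R)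
    (z : 'rV[R]_n * R) : R :=
  lim (tquot g z @ tfilter z).

Definition is_C1 (R : realType) (n : nat) (g : 'rV[R]_n * R -> R) : Prop :=
  [/\ {within Q 1, continuous g},
      (forall z, Q 1 z -> forall i : 'I_n,
         derivable (fun x => g (x, z.2)) z.1 (delta_mx 0 i)),
      (forall z, Q 1 z -> tderivable g z),
      (forall i : 'I_n, {within Q 1, continuous (fun z => grad g z ord0 i)}) &
      {within Q 1, continuous (tderiv g)}].

Definition is_C21 (R : realType) (n : nat) (g : 'rV[R]_n * R -> R) : Prop :=
  [/\ is_C1 g,
      (forall z, Q 1 z -> forall i j : 'I_n,
         derivable (fun x => grad g (x, z.2) ord0 i) z.1 (delta_mx 0 j)) &
      (forall i j : 'I_n, {within Q 1, continuous (fun z => hess g z i j)})].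

Definition grad_xt_norm (R : realType) (n : nat) (g : 'rV[R]_n * R -> R)
    (z : 'rV[R]_n * R) : R :=
  Num.sqrt (enorm (grad g z) ^+ 2 + tderiv g z ^+ 2).

Definition normalized_plap (R : realType) (n : nat) (p : R)
    (g : 'rV[R]_n * R -> R) (z : 'rV[R]_n * R) : R :=
  let e := (enorm (grad g z))^-1 *: grad g z in
  \tr (hess g z) + (p - 2) * dotr (e *m (hess g z)^T) e.

Definition ham (R : realType) (n : nat) (pp qq : R) (a : 'rV[R]_n * R -> R)
    (z : 'rV[R]_n * R) (xi : 'rV[R]_n) : R :=
  enorm xi `^ pp + a z * enorm xi `^ qq.

Definition local_max (R : realType) (n : nat) (g : 'rV[R]_n * R -> R)
    (z0 : 'rV[R]_n * R) : Prop :=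
  \forall z \near within (Q 1) (nbhs z0), g z <= g z0.

Definition local_min (R : realType) (n : nat) (g : 'rV[R]_n * R -> R)
    (z0 : 'rV[R]_n * R) : Prop :=
  \forall z \near within (Q 1) (nbhs z0), g z0 <= g z.

Definition locally_bounded (R : realType) (n : nat) (g : 'rV[R]_n * R -> R) :
    Prop :=
  forall z, Q 1 z -> bounded_near g (within (Q 1) (nbhs z)).

Definition is_lsc (R : realType) (n : nat) (g : 'rV[R]_n * R -> R) : Prop :=
  lower_semicontinuous (fun z : subspace (Q 1 : set ('rV[R]_n * R)) =>
    (g z)%:E).

Definition is_usc (R : realType) (n : nat) (g : 'rV[R]_n * R -> R) : Prop :=
  is_lsc (\- g).

Definition is_C1_itv (R : realType) (a b : R) (phi : R -> R) : Prop :=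
  {in `]a, b[, forall t, derivable phi t 1} /\
  {in `]a, b[, continuous ('D_1 phi)}.

(* Times of (t0 - d, t0 + d) at which a function on Q 1 is defined over x. *)
Definition twindow (R : realType) (n : nat) (x : 'rV[R]_n) (t0 d : R) : set R :=
  [set t | t0 - d < t < t0 + d /\ Q 1 (x, t)].

Definition subsolution (R : realType) (n : nat) (p pp qq : R)
    (a f u : 'rV[R]_n * R -> R) : Prop :=
  [/\ locally_bounded u, is_usc u &
   forall (x0 : 'rV[R]_n) (t0 : R), Q 1 (x0, t0) ->
   (forall phi : 'rV[R]_n * R -> R, is_C21 phi ->
      local_max (fun z => u z - phi z) (x0, t0) ->
      grad phi (x0, t0) != 0 ->
      tderiv phi (x0, t0) -
        ham pp qq a (x0, t0) (grad phi (x0, t0)) *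
          normalized_plap p phi (x0, t0) <= f (x0, t0)) /\
   (forall (d : R) (phi : R -> R), 0 < d ->
      is_C1_itv (t0 - d) (t0 + d) phi ->
      phi t0 = 0 ->
      (forall t, twindow x0 t0 d t -> u (x0, t0) >= u (x0, t) - phi t) ->
      (exists c : \bar R, \forall x \near x0,
         ereal_sup [set (u (x, t) - phi t)%:E | t in twindow x t0 d] = c) ->
      'D_1 phi t0 <= f (x0, t0))].

Definition supersolution (R : realType) (n : nat) (p pp qq : R)
    (a f u : 'rV[R]_n * R -> R) : Prop :=
  [/\ locally_bounded u, is_lsc u &
   forall (x0 : 'rV[R]_n) (t0 : R), Q 1 (x0, t0) ->
   (forall phi : 'rV[R]_n * R -> R, is_C21 phi ->
      local_min (fun z => u z - phi z) (x0, t0) ->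
      grad phi (x0, t0) != 0 ->
      tderiv phi (x0, t0) -
        ham pp qq a (x0, t0) (grad phi (x0, t0)) *
          normalized_plap p phi (x0, t0) >= f (x0, t0)) /\
   (forall (d : R) (phi : R -> R), 0 < d ->
      is_C1_itv (t0 - d) (t0 + d) phi ->
      phi t0 = 0 ->
      (forall t, twindow x0 t0 d t -> u (x0, t0) <= u (x0, t) - phi t) ->
      (exists c : \bar R, \forall x \near x0,
         ereal_inf [set (u (x, t) - phi t)%:E | t in twindow x t0 d] = c) ->
      'D_1 phi t0 >= f (x0, t0))].

Definition viscosity_solution (R : realType) (n : nat) (p pp qq : R)
    (a f u : 'rV[R]_n * R -> R) : Prop :=
  [/\ {within Q 1, continuous u}, subsolution p pp qq a f u &
      supersolution p pp qq a f u].

(* Upper limit of u at z along Q 1. It is u z at the points of Q 1 (bvalE); it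
   gives a meaning to the values of u at points of the closure of Q 1 that are
   not in Q 1, which the parabolic boundary of a subcylinder may contain. *)
Definition bval (R : realType) (n : nat) (u : 'rV[R]_n * R -> R)
    (z : 'rV[R]_n * R) : \bar R :=
  limf_esup (fun w => (u w)%:E) (within (Q 1) (nbhs z)).

Lemma bvalE (R : realType) (n : nat) (u : 'rV[R]_n * R -> R)
    (z : 'rV[R]_n * R) :
  {within Q 1, continuous u} -> Q 1 z -> bval u z = (u z)%:E.
Proof.
move=> cu Qz; rewrite /bval limf_esupE; apply/eqP; rewrite eq_le.
apply/andP; split; last first.
  apply: le_ereal_inf_tmp => _ [V VQ <-]; apply: ereal_sup_ubound.
  by exists z => //; exact: (nbhs_singleton VQ).
apply/lee_addgt0Pr => e e0.
have uz : \forall w \near within (Q 1) (nbhs z), `|u z - u w| < e.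
  have := cu z; rewrite /continuous_at => /cvgrPdist_lt /(_ _ e0).
  by rewrite {1}/nbhs /= /nbhs_subspace mem_set.
apply: ge_ereal_inf; eexists; first by exists [set w | `|u z - u w| < e]; [exact: uz|].
apply: ge_ereal_sup => _ [w /= wz <-]; rewrite -EFinD lee_fin.
by move: wz; rewrite ltr_distlC => /andP[_ /ltW].
Qed.

(* Main.v *)
Require Import Defs.
From mathcomp Require Import all_boot all_order all_algebra.
From mathcomp Require Import all_classical all_reals all_analysis.
From mathcomp Require Import ring lra.

(** The growth estimate is a comparison of [u] with the barrier
    [c * |x - x0|^theta + c * (t0 - t)].  The exponent
    [theta = (2 + pp) / (1 + pp) = 1 + 1 / (1 + pp)] is the one for which
    [|D v|^pp * D^2 v] is bounded when [v = c * |x - x0|^theta]; the bound is a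
    multiple of [c^(1 + pp)], and [|D v|^qq <= |D v|^pp] because the gradient is
    at most 1.  Hence for [c] small, depending on [n], [p], [sup |a|] and [c0]
    only, the barrier is a strict supersolution away from its tip [x = x0]: its
    time derivative is [- c] and the diffusion term is of order [c], so that
    their difference exceeds [c0 >= f].  If [u - u(z0)] stayed below
    [c/2 * r^theta] on the parabolic boundary, then [u] minus the barrier would
    have a maximum inside the cylinder, which the two clauses in the definition
    of a subsolution exclude ([sub_boundary_growth]).

    Away from the tip the maximum contradicts the clause on test functions with
    nonzero gradient ([sub_test_away]).  The barrier itself is in general not [C^2], but
    [|x - y|^theta] is a concave function of [|x - y|^2], so a paraboloid
    [k * |x - y|^2] touches it from above ([powR_sqr_tangent]); the paraboloid
    is the test function, and its derivatives are explicit.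

    At the tip ([sub_test_center]) the barrier with tip [y] is slid over all [y]
    near [x0].  By the previous case every maximum of [u - barrier] then sits
    over the tip, so the partial maximum [M y] of [u (y, t) - g t] in time
    satisfies [M x - M y <= C * |x - y|^theta].  As [theta > 1], [M] is locally
    constant ([holder_gt1_constant]), which is the situation of the clause on
    degenerate test functions; that clause gives [g' <= f <= c0], a
    contradiction.

    Two points need care.  The maximum must be reached strictly before the final
    time: the apex is moved slightly into the past and an exponential
    in time, small up to the apex and huge just after it, is added to the
    barrier.  And [u] is only controlled on the parabolic boundary through its
    upper limits, so the maximum is found as a cluster point in the closed
    cylinder of the superlevel sets of [u - barrier] ([compact_sup_point]). *)

Set Implicit Arguments.
Unset Strict Implicit.
Unset Printing Implicit Defensive.

Import Order.TTheory GRing.Theory Num.Theory.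
Import numFieldNormedType.Exports.

Local Open Scope classical_set_scope.
Local Open Scope ring_scope.

(** * The Euclidean norm and real powers *)

Lemma dotr_ge0 (R : realType) n (x : 'rV[R]_n) : 0 <= dotr x x.
Proof. by apply: sumr_ge0 => i _; rewrite -expr2 sqr_ge0. Qed.

Lemma enorm_ge0 (R : realType) n (x : 'rV[R]_n) : 0 <= enorm x.
Proof. exact: sqrtr_ge0. Qed.

Lemma enorm_sqr (R : realType) n (x : 'rV[R]_n) : enorm x ^+ 2 = dotr x x.
Proof. by rewrite sqr_sqrtr ?dotr_ge0. Qed.

Lemma dotrZ (R : realType) n a (x : 'rV[R]_n) :
  dotr (a *: x) (a *: x) = a ^+ 2 * dotr x x.
Proof. by rewrite /dotr mulr_sumr; apply: eq_bigr => i _; rewrite !mxE; ring. Qed.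

Lemma enormZ (R : realType) n a (x : 'rV[R]_n) : enorm (a *: x) = `|a| * enorm x.
Proof. by rewrite /enorm dotrZ sqrtrM ?sqr_ge0// sqrtr_sqr. Qed.

Lemma enormN (R : realType) n (x : 'rV[R]_n) : enorm (- x) = enorm x.
Proof. by rewrite -scaleN1r enormZ normrN1 mul1r. Qed.

Lemma enorm0 (R : realType) n : enorm (0 : 'rV[R]_n) = 0.
Proof. by rewrite -(scale0r (0 : 'rV[R]_n)) enormZ normr0 mul0r. Qed.

Lemma coord_le_enorm (R : realType) n (x : 'rV[R]_n) i : `|x ord0 i| <= enorm x.
Proof.
rewrite -sqrtr_sqr ler_wsqrtr// /dotr (bigD1 i)//= expr2 lerDl.
by apply: sumr_ge0 => j _; rewrite -expr2 sqr_ge0.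
Qed.

Lemma norm_le_enorm (R : realType) n (x : 'rV[R]_n) : `|x| <= enorm x.
Proof.
rewrite /Num.norm/= mx_normrE; apply/bigmax_leP; split; first exact: enorm_ge0.
by move=> [i j] _ /=; rewrite ord1 coord_le_enorm.
Qed.

Lemma enorm_eq0 (R : realType) n (x : 'rV[R]_n) : (enorm x == 0) = (x == 0).
Proof.
apply/eqP/eqP => [x0|->]; last exact: enorm0.
by apply/eqP; rewrite -normr_le0 -x0 norm_le_enorm.
Qed.

Lemma enorm_gt0 (R : realType) n (x : 'rV[R]_n) : (0 < enorm x) = (x != 0).
Proof. by rewrite lt_def enorm_ge0 andbT enorm_eq0. Qed.

(** This weak form of the triangle inequality suffices throughout: constants are
    not tracked sharply. *)
Lemma enorm_sqrD (R : realType) n (x y : 'rV[R]_n) :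
  enorm (x + y) ^+ 2 <= 2 * enorm x ^+ 2 + 2 * enorm y ^+ 2.
Proof.
rewrite !enorm_sqr /dotr !mulr_sumr -big_split/=; apply: ler_sum => i _.
rewrite !mxE -subr_ge0.
by rewrite (_ : _ - _ = (x ord0 i - y ord0 i) ^+ 2) ?sqr_ge0//; ring.
Qed.

Lemma enorm_continuous (R : realType) n : continuous (@enorm R n).
Proof.
move=> x; apply: (@continuous_comp _ _ _ (fun y => dotr y y) Num.sqrt).
  apply: (@continuous_big R _ +%R 0 xpredT _ _ _
    (fun i (y : 'rV[R]_n) => y ord0 i * y ord0 i)).
    exact: add_continuous.
  move=> i _ y; have ci := @coord_continuous R 1 n ord0 i y.
  exact: (continuousM ci ci).
exact: sqrt_continuous.
Qed.

Lemma powR_enorm_continuous (R : realType) n (th : R) : 1 <= th ->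
  continuous (fun x : 'rV[R]_n => enorm x `^ th).
Proof.
move=> th1 x; have [->|x0] := eqVneq x 0; last first.
  apply: (@continuous_comp _ _ _ (@enorm R n) (fun s => s `^ th)).
    exact: enorm_continuous.
  apply: differentiable_continuous; apply/derivable1_diffP.
  by apply: derivable_powR; rewrite in_itv/= andbT enorm_gt0.
rewrite /continuous_at enorm0 powR0 ?gt_eqF ?(lt_le_trans ltr01)//.
have e0 := @enorm_continuous R n 0; rewrite /continuous_at enorm0 in e0.
apply: (squeeze_cvgr _ (cvg_cst 0) e0).
near=> y; rewrite powR_ge0/=.
have [->|y0] := eqVneq y 0.
  by rewrite enorm0 powR0 // gt_eqF// (lt_le_trans ltr01).
apply: ge1r_powR => //; rewrite enorm_gt0 y0/= ltW//.
near: y; exact: (cvgr_lt _ e0).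
Unshelve. all: by end_near. Qed.

Lemma enorm_sub_continuous (R : realType) n (y : 'rV[R]_n) :
  continuous (fun x : 'rV[R]_n => enorm (x - y)).
Proof.
move=> x; have h : {for x, continuous (fun w : 'rV[R]_n => w - y)}.
  by apply: (@continuousB _ _ _ id (cst y)); [exact: cvg_id|exact: cst_continuous].
exact: (continuous_comp h (@enorm_continuous _ _ _)).
Qed.

(** Bernoulli's inequality for exponents at most 1: [t `^ al] is the exponential
    of [al * ln t], a convex combination of [ln t] and [0]. *)
Lemma powR_tangent (R : realType) (al t : R) : 0 < al <= 1 -> 0 <= t ->
  t `^ al <= 1 + al * (t - 1).
Proof.
move=> /andP[a0 a1]; rewrite le_eqVlt => /predU1P[<-|t0].
  by rewrite powR0 ?gt_eqF//; lra.
have := @convex_expR R (Itv01 (ltW a0) a1) (ln t) 0.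
rewrite !convRE/= expR0 lnK// mulr0 addr0.
rewrite /powR gt_eqF// => h; apply: le_trans h _.
by rewrite /unstable.onem; lra.
Qed.

Lemma powRD_gt0 (R : realType) (x r s : R) : 0 < x ->
  x `^ (r + s) = x `^ r * x `^ s.
Proof. by move=> x0; rewrite powRD// (gt_eqF x0); exact: implybT. Qed.

(** [s `^ th] is a concave function of [s ^+ 2] and lies below its tangent at
    [r ^+ 2]; this is how a power is touched from above by a paraboloid. *)
Lemma powR_sqr_tangent (R : realType) (th s r : R) :
  0 < th <= 2 -> 0 <= s -> 0 < r ->
  s `^ th <= r `^ th + th / 2 * r `^ (th - 2) * (s ^+ 2 - r ^+ 2).
Proof.
move=> /andP[th0 th2] s0 r0.
have -> : s `^ th = ((s / r) ^+ 2) `^ (th / 2) * r `^ th.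
  rewrite -powR_mulrn ?divr_ge0 ?(ltW r0)// -powRrM.
  rewrite (_ : 2 * (th / 2) = th); last by field.
  by rewrite -powRM ?divr_ge0 ?(ltW r0)// divfK ?gt_eqF.
have rth : r `^ th = r `^ (th - 2) * r ^+ 2.
  by rewrite -powR_mulrn ?(ltW r0)// -powRD ?subrK ?(gt_eqF r0) ?implybT.
have -> : r `^ th + th / 2 * r `^ (th - 2) * (s ^+ 2 - r ^+ 2) =
    (1 + th / 2 * ((s / r) ^+ 2 - 1)) * r `^ th.
  by rewrite rth; field; rewrite gt_eqF.
by rewrite ler_wpM2r ?powR_ge0// powR_tangent ?sqr_ge0//; lra.
Qed.

(** The norm of a sum is at most twice the larger norm, and [2 `^ th <= 4]. *)
Lemma powR_enormD (R : realType) n (th : R) (x y : 'rV[R]_n) : 0 <= th <= 2 ->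
  enorm (x + y) `^ th <= 4 * (enorm x `^ th + enorm y `^ th).
Proof.
move=> /andP[th0 th2].
wlog xy : x y / enorm x <= enorm y => [hw|].
  have [/hw//|/ltW/hw] := leP (enorm x) (enorm y).
  by rewrite addrC [X in 4 * X]addrC.
have h : enorm (x + y) <= 2 * enorm y.
  rewrite -(@ler_pXn2r _ 2) ?nnegrE ?mulr_ge0 ?enorm_ge0//.
  have := enorm_sqrD x y; have := enorm_ge0 x; rewrite exprMn; nra.
apply: (@le_trans _ _ ((2 * enorm y) `^ th)).
  by apply: ge0_ler_powR; rewrite ?nnegrE ?mulr_ge0 ?enorm_ge0.
rewrite powRM ?enorm_ge0//.
have : 2 `^ th <= 4 :> R.
  apply: (@le_trans _ _ (2 `^ 2)); first by apply: ler_powR => //; lra.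
  by rewrite powR_mulrn//; lra.
have := powR_ge0 (enorm x) th; have := powR_ge0 (enorm y) th; nra.
Qed.

(** Cutting a segment from the centre into [N] equal pieces bounds the increment
    by [N * c * (|x - x0| / N)^th], which tends to [0] because [th > 1]. *)
Lemma holder_gt1_constant (R : realType) n (M : 'rV[R]_n -> R) x0 (d c th : R) :
  1 < th ->
  (forall x y, eball d x0 x -> eball d x0 y ->
    `|M x - M y| <= c * enorm (x - y) `^ th) ->
  forall x, eball d x0 x -> M x = M x0.
Proof.
move=> th1 hM x xd; apply/eqP; rewrite -subr_eq0 -normr_le0 leNgt.
apply/negP => D0.
set D := `|_| in D0.
set r := enorm (x - x0).
have d0 : 0 < d by apply: le_lt_trans xd; exact: enorm_ge0.
have DN N : (0 < N)%N -> D * N%:R `^ (th - 1) <= c * r `^ th.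
  move=> N0; have NR : (0 : R) < N%:R by rewrite ltr0n.
  pose q k := x0 + (k%:R / N%:R) *: (x - x0).
  have qd k : (k <= N)%N -> eball d x0 (q k).
    move=> kN; rewrite /eball/= /q addrC addKr enormZ ger0_norm ?divr_ge0 ?ler0n//.
    apply: le_lt_trans xd; rewrite ler_piMl ?enorm_ge0//.
    by rewrite ler_pdivrMr// mul1r ler_nat.
  have stp k : (k <= N)%N -> `|M (q k) - M x0| <= k%:R * (c * (r / N%:R) `^ th).
    elim: k => [|k IH] kN.
      by rewrite /q mul0r scale0r addr0 subrr normr0 mul0r.
    rewrite (_ : M _ - M _ = (M (q k.+1) - M (q k)) + (M (q k) - M x0));
      last by ring.
    apply: le_trans (ler_normD _ _) _; rewrite -natr1 mulrDl mul1r addrC.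
    rewrite lerD ?IH 1?ltnW//.
    apply: le_trans (hM _ _ (qd _ kN) (qd _ (ltnW kN))) _.
    rewrite (_ : q k.+1 - q k = N%:R^-1 *: (x - x0)); last first.
      rewrite /q -natr1 mulrDl scalerDl mul1r opprD addrACA subrr add0r.
      by rewrite addrAC subrr add0r.
    by rewrite enormZ ger0_norm ?invr_ge0 ?ler0n// [_^-1 * _]mulrC.
  have := stp N (leqnn _); rewrite /q divff ?gt_eqF// scale1r.
  rewrite [x0 + _]addrC subrK -/D.
  have -> : (r / N%:R) `^ th = r `^ th * (N%:R `^ (th - 1) * N%:R)^-1.
    rewrite powRM ?enorm_ge0 ?invr_ge0 ?ler0n//; congr (_ * _).
    have <- : N%:R `^ th = N%:R `^ (th - 1) * N%:R :> R.
      by rewrite -[X in _ * X]powRr1 ?ler0n// -powRD_gt0// subrK.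
    by rewrite -powR_inv1 ?ler0n// -powRrM mulN1r powRN.
  have P0 : 0 < N%:R `^ (th - 1) :> R by rewrite powR_gt0.
  rewrite (_ : N%:R * _ = (c * r `^ th) / N%:R `^ (th - 1)); last first.
    by field; rewrite !gt_eqF.
  by rewrite ler_pdivlMr.
have thm : 0 < th - 1 by lra.
set K := c * r `^ th in DN.
have K0 : 0 <= K.
  by apply: le_trans (DN 1%N isT); rewrite mulr_ge0 ?powR_ge0 ?(ltW D0).
pose s := ((K + 1) / D) `^ (th - 1)^-1.
pose N := (Num.truncn s).+1.
have sN : s < N%:R by rewrite /N truncnS_gt.
have := DN N isT; apply/negP; rewrite -ltNge mulrC -ltr_pdivrMr//.
apply: (@lt_le_trans _ _ ((K + 1) / D)).
  by rewrite ltr_pM2r ?invr_gt0//; lra.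
rewrite (_ : (K + 1) / D = s `^ (th - 1)); last first.
  by rewrite /s -powRrM mulVf ?gt_eqF// powRr1// divr_ge0 ?(ltW D0)//; lra.
by apply: ge0_ler_powR; rewrite ?nnegrE ?powR_ge0 ?ler0n ?(ltW sN)// ltW.
Qed.

(** * Neighbourhoods and compactness in space-time *)

(** The topology comes from the max norm, whose balls contain the Euclidean balls. *)
Lemma nbhs_box (R : realType) n (x : 'rV[R]_n) (t : R) (P : set ('rV[R]_n * R)) :
  nbhs (x, t) P ->
  exists2 e, 0 < e & forall y s, enorm (y - x) < e -> `|s - t| < e -> P (y, s).
Proof.
move=> /nbhs_ballP[e /= e0 eP]; exists e => // y s yx st; apply: eP; split => /=.
  rewrite -ball_normE/= distrC; exact: le_lt_trans (norm_le_enorm _) yx.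
by rewrite -ball_normE/= distrC.
Qed.

Lemma nbhs_cylinder (R : realType) n (x0 : 'rV[R]_n) (r s1 s2 : R) z :
  enorm (z.1 - x0) < r -> s1 < z.2 < s2 ->
  \forall w \near z, enorm (w.1 - x0) < r /\ s1 < w.2 < s2.
Proof.
move=> zr /andP[z1 z2].
have ce : (fun w : 'rV[R]_n * R => enorm (w.1 - x0)) @ z --> enorm (z.1 - x0).
  have h : {for z, continuous (fun w : 'rV[R]_n * R => w.1 - x0)}.
    by apply: cvgB; [exact: cvg_fst|exact: cvg_cst].
  exact: (continuous_comp h (@enorm_continuous _ _ _)).
have cs : (fun w : 'rV[R]_n * R => w.2) @ z --> z.2 by exact: cvg_snd.
near=> w; split; first by near: w; exact: (cvgr_lt _ ce).
by apply/andP; split; near: w; [exact: (cvgr_gt _ cs)|exact: (cvgr_lt _ cs)].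
Unshelve. all: by end_near. Qed.

Lemma compact_cylinder (R : realType) n (x0 : 'rV[R]_n) (r s1 s2 : R) :
  compact ([set x | enorm (x - x0) <= r] `*` [set t | s1 <= t <= s2]).
Proof.
apply: compact_setX; last first.
  rewrite (_ : [set t | _] = `[s1, s2]%classic); first exact: segment_compact.
  by apply/seteqP; split => t /=; rewrite in_itv.
apply: bounded_closed_compact.
  exists (`|x0| + r); split; first exact: num_real.
  move=> M rM x /= xr; apply/ltW/le_lt_trans/rM.
  rewrite -(subrK x0 x) addrC (le_trans (ler_normD _ _))//.
  by rewrite lerD2l; apply: le_trans xr; exact: norm_le_enorm.
rewrite (_ : [set x | _] = (fun x => enorm (x - x0)) @^-1` [set s | s <= r])//.
apply: closed_comp; last exact: closed_le.
by move=> x _; exact: enorm_sub_continuous.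
Qed.

Lemma nbhs_eball (R : realType) n (r : R) (y : 'rV[R]_n) :
  0 < r -> nbhs y (eball r y).
Proof.
move=> r0; have := @enorm_sub_continuous R n y y; rewrite /continuous_at subrr enorm0.
by move/cvgr_lt => /(_ _ r0).
Qed.

Lemma power_barrier_continuous (R : realType) n (k th : R) (y : 'rV[R]_n)
    (g : R -> R) :
  1 <= th -> continuous g ->
  continuous (fun z : 'rV[R]_n * R => k * enorm (z.1 - y) `^ th + g z.2).
Proof.
move=> th1 cg z.
have h : {for z, continuous (fun w : 'rV[R]_n * R => w.1 - y)}.
  by apply: cvgB; [exact: cvg_fst|exact: cvg_cst].
have h1 : (fun w : 'rV[R]_n * R => enorm (w.1 - y) `^ th) @ z -->
    enorm (z.1 - y) `^ th.
  exact: (continuous_comp h (@powR_enorm_continuous _ _ _ th1 _)).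
apply: cvgD; first exact: cvgMr.
by apply: (@continuous_comp _ _ _ snd g); [exact: cvg_snd|exact: cg].
Qed.

Lemma nbhs_Q1 (R : realType) n (z : 'rV[R]_n * R) :
  Q 1 z -> z.2 < 0 -> nbhs z (@Q R n 1).
Proof.
case: z => x t [/= x1 /andP[t1 t0]] t0'.
apply: filterS (@nbhs_cylinder R n 0 1 (- 1 ^+ 2) 0 (x, t) x1 _).
  by move=> w [w1 /andP[w2 w3]]; split=> //=; rewrite w2 ltW.
by rewrite /= t1.
Qed.

(** The point is a cluster point of the filter of superlevel sets of [w].  It
    plays the part of a maximum point when [w] is only controlled near [K] by its
    upper limits. *)
Lemma compact_sup_point (T : topologicalType) (R : realType) (K E : set T)
    (w : T -> R) : compact K -> E `<=` K -> E !=set0 ->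
  exists2 p, K p & forall V m, nbhs p V ->
    (exists2 z, E z & m < w z) -> exists2 z, (E `&` V) z & m < w z.
Proof.
move=> cK EK [z1 Ez1].
pose D := [set m | exists2 z, E z & m < w z].
pose B m := [set z | E z /\ m < w z].
have FF : ProperFilter (filter_from D B).
  apply: filter_from_proper; last by move=> m [z Ez mz]; exists z.
  apply: filter_from_filter.
    by exists (w z1 - 1), z1 => //; rewrite ltrBlDr ltrDl.
  move=> i j [y Ey iy] [z Ez jz]; exists (Num.max i j).
    have [ij|ji] := leP i j; first by exists z.
    by exists y.
  by move=> v [Ev]; rewrite gt_max => /andP[iv jv].
have [|p [Kp cp]] := cK _ FF.
  exists (w z1 - 1); last by move=> z [/EK].
  by exists z1 => //; rewrite ltrBlDr ltrDl.
exists p => // V m pV Dm.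
have [z [[Ez mz] Vz]] : (B m `&` V) !=set0 by apply: cp => //; exists m.
by exists z.
Qed.

Lemma bval_lt (R : realType) n (u : 'rV[R]_n * R -> R) p (m : R) :
  (bval u p < m%:E)%E -> \forall w \near within (Q 1) (nbhs p), u w < m.
Proof.
rewrite /bval limf_esupE => /ereal_inf_lt[_ [V QV <-] Vm].
apply: filterS QV => w Vw; rewrite -lte_fin; apply: le_lt_trans Vm.
by apply: ereal_sup_ubound; exists w.
Qed.

(** * Paraboloids as test functions *)

(** The difference quotient of [f] along [v] is exactly [l + h * m]. *)
Lemma is_derive_quadratic (R : realType) (V : normedModType R) (f : V -> R)
    (x v : V) (l m : R) :
  (forall h, f (h *: v + x) - f x = h * l + h ^+ 2 * m) -> is_derive x v f l.
Proof.
move=> fE.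
have fl : h^-1 *: ((f \o shift x) (h *: v) - f x) @[h --> 0^'] --> l.
  have : (l + h * m) @[h --> (0:R)^'] --> l + 0 * m.
    by apply: cvgD; [exact: cvg_cst|apply: cvgMl; exact: cvg_within].
  rewrite mul0r addr0; apply: cvg_trans; apply: near_eq_cvg.
  near=> h; rewrite /= fE /GRing.scale/=.
  have h0 : h != 0 by near: h; exact: nbhs_dnbhs_neq.
  by field.
by apply: DeriveDef; [exact: cvgP fl|exact: cvg_lim fl].
Unshelve. all: by end_near. Qed.

(** The limit is one-sided at time [0] and two-sided before; restricting the
    increments to the domain keeps it. *)
Lemma tquot_cvg (R : realType) n (g : R -> R) (b : 'rV[R]_n -> R) z :
  Q 1 z -> derivable g z.2 1 ->
  tquot (fun z => b z.1 + g z.2) z @ tfilter z --> 'D_1 g z.2.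
Proof.
case: z => x t /= Qz dg.
have h0 : h^-1 *: ((g \o shift t) (h *: 1) - g t) @[h --> 0^'] --> 'D_1 g t.
  exact: dg.
apply: cvg_within_filter.
have -> : tquot (fun z => b z.1 + g z.2) (x, t) =
  (fun h => h^-1 *: ((g \o shift t) (h *: 1) - g t)) \o (fun s => s - t).
  apply/funext => s; rewrite /tquot/= /GRing.scale/= mulr1 subrK.
  by congr (_ * _); ring.
apply: (cvg_comp _ _ _ h0).
move=> A; rewrite /= /dnbhs /nbhs/= /within/= => A0.
have := A0; rewrite [X in X -> _](near_shift t 0) => {}A0.
apply: filterS A0 => s /=; rewrite sub0r => As st; apply: As.
by rewrite subr_eq0.
Qed.

Lemma tfilter_proper (R : realType) n (z : 'rV[R]_n * R) :
  Q 1 z -> ProperFilter (tfilter z).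
Proof.
case: z => x t [/= x1 /andP[t1 t0]].
apply: Build_ProperFilter_ex => A; rewrite /tfilter/=.
move=> [e /= e0 Ae].
pose m := Num.min (e / 2) ((t + 1) / 2).
have t10 : 0 < t + 1 by move: t1; rewrite expr1n; lra.
have m0 : 0 < m by rewrite lt_min !divr_gt0.
have me : m <= e / 2 by rewrite ge_min lexx.
have mt : m <= (t + 1) / 2 by rewrite ge_min lexx orbT.
exists (t - m); apply: Ae => /=.
- rewrite opprB addrC subrK gtr0_norm//; lra.
- by apply/negP => /eqP; lra.
- split => //=; rewrite expr1n; apply/andP; split; lra.
Qed.

Definition quad_test (R : realType) n (k : R) (y : 'rV[R]_n) (g : R -> R) :
  'rV[R]_n * R -> R := fun z => k * enorm (z.1 - y) ^+ 2 + g z.2.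

Section quad_test.
Variables (R : realType) (n : nat) (k : R) (y : 'rV[R]_n) (g : R -> R).
Hypotheses (dg : forall t, derivable g t 1) (cg : continuous ('D_1 g)).
Local Notation phi := (quad_test k y g).

Let quad_der x t (i : 'I_n) :
  is_derive x (delta_mx 0 i) (fun x => phi (x, t)) (2 * k * (x - y) 0 i).
Proof.
apply: (is_derive_quadratic (m := k)) => h.
rewrite /quad_test/= !enorm_sqr.
have -> : dotr (h *: delta_mx 0 i + x - y) (h *: delta_mx 0 i + x - y) =
   dotr (x - y) (x - y) + 2 * h * (x - y) 0 i + h ^+ 2.
  rewrite /dotr (bigD1 i)//= [in RHS](bigD1 i)//= !mxE !eqxx.
  under eq_bigr => j ji do rewrite !mxE/= (negbTE ji) mulr0 add0r.
  under [in RHS]eq_bigr => j ji do rewrite !mxE/=.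
  by rewrite /=; ring.
by ring.
Qed.

Lemma grad_quad_test z : grad phi z = (2 * k) *: (z.1 - y).
Proof.
apply/rowP => i; rewrite !mxE.
by have := quad_der z.1 z.2 i; rewrite !mxE => h; rewrite derive_val.
Qed.

Let grad_der x t (i j : 'I_n) :
  is_derive x (delta_mx 0 j) (fun x => grad phi (x, t) ord0 i)
    (2 * k * (i == j)%:R).
Proof.
apply: (is_derive_quadratic (m := 0)) => h.
by rewrite !grad_quad_test/= !mxE/= ?eqxx/=; ring.
Qed.

Lemma hess_quad_test z : hess phi z = (2 * k)%:M.
Proof.
apply/matrixP => i j; rewrite !mxE.
have h := grad_der z.1 z.2 i j; rewrite derive_val.
exact: mulr_natr.
Qed.

Lemma tderiv_quad_test z : Q 1 z -> tderiv phi z = 'D_1 g z.2.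
Proof.
move=> Qz; apply: cvg_lim => //; first exact: tfilter_proper.
exact: (@tquot_cvg _ _ g (fun x => k * enorm (x - y) ^+ 2)).
Qed.

Lemma is_C21_quad_test : is_C21 phi.
Proof.
have gc : continuous g.
  by move=> t; apply: differentiable_continuous; exact/derivable1_diffP.
have fstc : continuous (fun z : 'rV[R]_n * R => z.1 - y).
  by move=> z; apply: cvgB; [exact: cvg_fst|exact: cvg_cst].
split; first split.
- apply: continuous_subspaceT => z.
  have e1 : (fun z : 'rV[R]_n * R => enorm (z.1 - y)) @ z --> enorm (z.1 - y).
    by apply: (continuous_comp (fstc z)); exact: enorm_continuous.
  apply: cvgD.
    by apply: cvgMr; exact: (cvgM e1 e1).
  by apply: (@continuous_comp _ _ _ snd g); [exact: cvg_snd|exact: gc].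
- by move=> z _ i; have [] := quad_der z.1 z.2 i.
- move=> z Qz; apply: cvgP.
  exact: (@tquot_cvg _ _ g (fun x => k * enorm (x - y) ^+ 2)).
- move=> i; apply: continuous_subspaceT => z.
  have -> : (fun z => grad phi z ord0 i) = (fun z => 2 * k * (z.1 - y) 0 i).
    by apply/funext => w; rewrite grad_quad_test mxE.
  apply: cvgMr.
  exact: (continuous_comp (fstc z) (@coord_continuous R 1 n 0 i _)).
- apply: (@subspace_eq_continuous _ _ _ (fun z => 'D_1 g z.2)).
    move=> z; rewrite inE => Qz; exact: (esym (tderiv_quad_test Qz)).
  apply: continuous_subspaceT => z.
  by apply: (@continuous_comp _ _ _ snd ('D_1 g)); [exact: cvg_snd|exact: cg].
- by move=> z _ i j; have [] := grad_der z.1 z.2 i j.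
- move=> i j; apply: continuous_subspaceT => z.
  have -> : (fun z => hess phi z i j) = (fun=> (2 * k)%:M i j).
    by apply/funext => w; rewrite hess_quad_test.
  exact: cvg_cst.
Qed.

Lemma normalized_plap_quad_test p z : z.1 != y -> k != 0 ->
  normalized_plap p phi z = 2 * k * (n%:R + p - 2).
Proof.
move=> zy k0; rewrite /normalized_plap hess_quad_test grad_quad_test mxtrace_scalar.
have xy : (2 * k) *: (z.1 - y) != 0.
  by rewrite scaler_eq0 mulf_eq0 pnatr_eq0/= negb_or k0 subr_eq0.
set v := _ *: (z.1 - y) in xy *; set e := _ *: v.
rewrite tr_scalar_mx mul_mx_scalar.
have -> : dotr ((2 * k) *: e) e = 2 * k * dotr e e.
  by rewrite /dotr mulr_sumr; apply: eq_bigr => i _; rewrite !mxE; ring.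
rewrite -enorm_sqr /e enormZ normfV ger0_norm ?enorm_ge0// mulVf ?enorm_eq0//.
by rewrite -mulr_natr; ring.
Qed.

End quad_test.

(** * Comparison with the barrier *)

Section barrier.
Variables (R : realType) (n : nat) (p pp qq th A c0 : R).
Hypotheses (n0 : (0 < n)%N) (p1 : 1 < p) (pp0 : 0 <= pp) (ppqq : pp <= qq).
Hypothesis thE : th = (2 + pp) / (1 + pp).

Lemma th_bounds : 1 < th <= 2.
Proof.
have h : 0 < 1 + pp by move: pp0; lra.
by rewrite thE ltr_pdivlMr ?ler_pdivrMr//; apply/andP; split; move: pp0; lra.
Qed.

Lemma dim_pos : 0 <= n%:R + p - 2.
Proof.
have : (1 : R) <= n%:R by rewrite ler1n.
by move: p1; lra.
Qed.

(** The paraboloid [k * |x - y|^2] with the slope of [c * |x - y|^th] at distance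
    [r] has a gradient of norm [2 * k * r = c * th * r `^ (th - 1)], at most 1, and
    Hessian [2 * k] times the identity; since [(th - 1) * (1 + pp) = 1], the powers
    of [r] cancel in [(2 * k * r) `^ pp * (2 * k) = (c * th) `^ (1 + pp)]. *)
Lemma barrier_flux_bound (c r al k : R) :
  0 < c -> c <= 1 / 4 -> 0 < r -> r <= 2 -> al <= A -> 0 <= A ->
  k = c * (th / 2 * r `^ (th - 2)) ->
  ((2 * k * r) `^ pp + al * (2 * k * r) `^ qq) * (2 * k) <= 2 * c * (1 + A).
Proof.
move=> c0' c4 r0 r2 alA A0 kE; have pp0' := pp0; have /andP[th1 th2] := th_bounds.
have k0 : 0 < k by rewrite kE !mulr_gt0 ?powR_gt0//; lra.
set G := 2 * k * r.
have GE : G = c * th * r `^ (th - 1).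
  rewrite (_ : th - 1 = th - 2 + 1); last by ring.
  by rewrite powRD_gt0// powRr1 ?(ltW r0)// /G kE; field.
have G0 : 0 < G by rewrite !mulr_gt0.
have G1 : G <= 1.
  have : r `^ (th - 1) <= 2.
    apply: (@le_trans _ _ (2 `^ (th - 1))).
      by apply: ge0_ler_powR; rewrite ?nnegrE//; lra.
    by apply: ler1_powR; lra.
  move=> rth; rewrite GE; apply: (@le_trans _ _ (1 / 2 * 2)); last lra.
  by rewrite ler_pM ?powR_ge0// ?mulr_ge0//; nra.
have Gk : G `^ pp * (2 * k) <= 2 * c.
  rewrite -(ler_pM2r r0) -mulrA -/G.
  have -> : G `^ pp * G = (c * th) `^ (1 + pp) * r.
    rewrite -[X in _ * X](powRr1 (ltW G0)) -powRD_gt0//.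
    rewrite GE powRM ?powR_ge0 ?mulr_ge0//; try lra.
    rewrite -powRrM [pp + 1]addrC (_ : (th - 1) * (1 + pp) = 1).
      by rewrite powRr1// ltW.
    by rewrite thE; field; lra.
  rewrite ler_pM2r//; apply: (@le_trans _ _ (c * th)); last nra.
  by apply: ge1r_powR; last lra; apply/andP; split; nra.
have Gq : G `^ qq <= G `^ pp by apply: ger_powR; rewrite ?G0.
have := powR_ge0 G qq; have := powR_ge0 G pp => Gp0 Gq0.
have : G `^ pp + al * G `^ qq <= (1 + A) * G `^ pp.
  have : al * G `^ qq <= A * G `^ qq by rewrite ler_wpM2r.
  have : A * G `^ qq <= A * G `^ pp by rewrite ler_wpM2l.
  lra.
have k20 : 0 <= 2 * k by lra.
move=> /(ler_wpM2r k20) h; apply: le_trans h _.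
have A1 : 0 <= 1 + A by lra.
by have := ler_wpM2l A1 Gk; lra.
Qed.

Variables (a f u : 'rV[R]_n * R -> R).
Hypotheses (A0 : 0 <= A) (aA : forall z, Q 1 z -> a z <= A)
  (fc0 : forall z, Q 1 z -> f z <= c0) (usub : subsolution p pp qq a f u)
  (cu : {within Q 1, continuous u}).

(** Keeps only the standing assumptions: what an arithmetic step uses is the goal
    before it. *)
Ltac forget :=
  clear - R n p pp qq th A c0 n0 p1 pp0 ppqq thE a f u A0 aA fc0 usub cu.

(** The barrier is touched from above at [x1] by a paraboloid; the bound on [g'] is
    what the clause on nonzero gradients says of that paraboloid. *)
Lemma sub_test_away (c : R) (y x1 : 'rV[R]_n) (t1 : R) (g : R -> R) :
  0 < c -> c <= 1 / 4 -> eball 1 0 y ->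
  (forall t, derivable g t 1) -> continuous ('D_1 g) ->
  Q 1 (x1, t1) -> x1 != y ->
  local_max (fun z => u z - (c * enorm (z.1 - y) `^ th + g z.2)) (x1, t1) ->
  'D_1 g t1 <= c0 + 2 * c * (1 + A) * (n%:R + p - 2).
Proof.
move=> c0' c4 y1 dg cg Q1 xy lm; have /andP[th1 th2] := th_bounds.
set r := enorm (x1 - y).
have r0 : 0 < r by rewrite enorm_gt0 subr_eq0.
have r2 : r <= 2.
  have := enorm_sqrD x1 (- y); rewrite -/r enormN.
  move: Q1 y1 => [/= + _]; rewrite /eball/= !subr0 => x11 y1.
  have := enorm_ge0 x1; have := enorm_ge0 y; nra.
pose k := c * (th / 2 * r `^ (th - 2)).
have k0 : 0 < k by rewrite /k !mulr_gt0 ?powR_gt0//; lra.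
have [_ _ /(_ x1 t1 Q1)[test _]] := usub.
have := test (quad_test k y g) (is_C21_quad_test k y dg cg).
have lmq : local_max (fun z => u z - quad_test k y g z) (x1, t1).
  apply: filterS lm => z /=; rewrite /quad_test/= -/r => h.
  have : c * enorm (z.1 - y) `^ th <=
      c * r `^ th + k * (enorm (z.1 - y) ^+ 2 - r ^+ 2).
    rewrite /k -mulrA -mulrDr ler_wpM2l ?(ltW c0')//.
    by apply: powR_sqr_tangent; rewrite ?enorm_ge0// (lt_trans ltr01 th1).
  move: h; move: (enorm (z.1 - y) `^ th) (r `^ th) (enorm (z.1 - y) ^+ 2).
  by forget => *; lra.
move=> /(_ lmq); rewrite (grad_quad_test k y g (x1, t1)).
rewrite (tderiv_quad_test k y dg)//=.
rewrite normalized_plap_quad_test ?gt_eqF//= /ham enormZ -/r gtr0_norm; last lra.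
have gn0 : (2 * k) *: (x1 - y) != 0.
  by rewrite scaler_eq0 negb_or subr_eq0 xy andbT gt_eqF//; lra.
move=> /(_ gn0) h.
have hb := barrier_flux_bound c0' c4 r0 r2 (aA Q1) A0 (erefl k).
have := ler_wpM2r dim_pos hb; have := fc0 Q1; rewrite mulrA in h.
by move: h; forget; lra.
Qed.

(** The maximum over the tip is first made strict, by adding [(t - t1)^2] and by
    multiplying [c] by 8; then a barrier whose tip [y] is close to [x1] still has
    its maxima in a small box around [(x1, t1)], and by [sub_test_away] they lie
    over [y].  The inequality [M x - M y <= 8 * c * |x - y|^th] between the values
    [M y] of these maxima makes [M] constant near [x1]. *)
Lemma sub_test_center (c : R) (x1 : 'rV[R]_n) (t1 : R) (g : R -> R) :
  0 < c -> 32 * c <= 1 ->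
  2 * c + 16 * c * (1 + A) * (n%:R + p - 2) < - c0 ->
  (forall t, derivable g t 1) -> continuous ('D_1 g) ->
  (forall t, - c <= 'D_1 g t) ->
  Q 1 (x1, t1) -> t1 < 0 ->
  ~ local_max (fun z => u z - (c * enorm (z.1 - x1) `^ th + g z.2)) (x1, t1).
Proof.
move=> cp c32 csmall dg cg gc Qz1 t10 lm.
have /andP[th1 th2] := th_bounds; have th0 : 0 < th := lt_trans ltr01 th1.
pose gg (t : R) : R := g t + (t - t1) ^+ 2.
have dgg (t : R) : is_derive t 1 gg ('D_1 g t + 2 * (t - t1)).
  have d1 : is_derive t 1 g ('D_1 g t) by apply: DeriveDef.
  have d2 : is_derive t 1 (fun t => (t - t1) ^+ 2) (2 * (t - t1)).
    by apply: (is_derive_quadratic (m := 1)) => h; rewrite /GRing.scale/=; ring.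
  exact: is_deriveD.
have ggE : 'D_1 gg = fun t => 'D_1 g t + 2 * (t - t1).
  by apply/funext => t; have := dgg t => h; rewrite derive_val.
have cgg : continuous ('D_1 gg).
  rewrite ggE => t; apply: cvgD; first exact: cg.
  apply: cvgMr; apply: (@continuousB _ _ _ id (cst t1)); first exact: cvg_id.
  exact: cst_continuous.
have dgg' (t : R) : derivable gg t 1 by have [] := dgg t.
have gg1 : gg t1 = g t1 by rewrite /gg subrr expr0n addr0.
pose M0 := u (x1, t1) - g t1.
have [e e0 he] : exists2 e, 0 < e &
  forall y s, enorm (y - x1) < e -> `|s - t1| < e ->
    Q 1 (y, s) /\ u (y, s) - (c * enorm (y - x1) `^ th + g s) <= M0.
  have [e e0 he] := nbhs_box (filterI (nbhs_Q1 Qz1 t10) lm).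
  exists e => // y s yx st; have [Qy] := he _ _ yx st; rewrite /= => h; split => //.
  apply: le_trans (h Qy) _; rewrite subrr enorm0 powR0 ?gt_eqF//.
  by rewrite mulr0 add0r.
pose rho := e / 2; pose d := Num.min rho (c / 2).
have rho0 : 0 < rho by rewrite divr_gt0.
have d0 : 0 < d by rewrite lt_min rho0 divr_gt0.
have drho : d <= rho by rewrite ge_min lexx.
have dc : d <= c / 2 by rewrite ge_min lexx orbT.
pose K := [set x | enorm (x - x1) <= rho] `*` [set t | t1 - d <= t <= t1 + d].
have hK z : K z -> Q 1 z /\ u z - (c * enorm (z.1 - x1) `^ th + g z.2) <= M0.
  case: z => y s [/= yr /andP[s1 s2]]; apply: he.
    by apply: le_lt_trans yr _; rewrite /rho; move: e0; forget; lra.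
  by rewrite ltr_norml; apply/andP; move: drho s1 s2 e0; rewrite /rho; forget; lra.
have Kc : compact K by exact: compact_cylinder.
have Kz1 : K (x1, t1).
  split; rewrite /= ?subrr ?enorm0 ?(ltW rho0)//.
  by move: d0; forget => d0; apply/andP; split; lra.
pose w y z := u z - (8 * c * enorm (z.1 - y) `^ th + gg z.2).
pose m := Num.min (d ^+ 2) (c * rho `^ th).
have m0 : 0 < m by rewrite lt_min exprn_gt0// mulr_gt0 ?powR_gt0.
(* For [enorm (y - x1) <= 1] the power is at most [enorm (y - x1)], whence the
   explicit radius. *)
pose dl := Num.min (Num.min 1 rho) (m / (16 * c)).
have dl0 : 0 < dl by rewrite !lt_min ltr01 rho0 divr_gt0// mulr_gt0.
have hdl y : eball dl x1 y ->
    enorm (y - x1) < rho /\ 16 * c * enorm (y - x1) `^ th < m.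
  rewrite /eball/= => yd; have {yd}: enorm (y - x1) < dl by [].
  move: @m m0 @dl dl0 => m m0 dl dl0; rewrite /dl 2!lt_min.
  move=> /andP[/andP[y1 y2] y3]; split => //.
  apply: (@le_lt_trans _ _ (16 * c * enorm (y - x1))).
    rewrite ler_pM2l; last by rewrite mulr_gt0.
    have [->|y0] := eqVneq (y - x1) 0; first by rewrite enorm0 powR0// gt_eqF.
    by apply: ge1r_powR; rewrite ?enorm_gt0 ?y0 ?(ltW y1)// ltW.
  by rewrite mulrC -ltr_pdivlMr// mulr_gt0.
have maxw y : eball dl x1 y -> exists t, `|t - t1| < d /\
    forall z, K z -> w y z <= u (y, t) - gg t.
  move=> yd; have [yrho ysm] := hdl _ yd.
  have wcont : {within K, continuous (w y)}.
    have uc : {within K, continuous u}.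
      by apply: continuous_subspaceW cu => v /hK[].
    have bc : {within K, continuous
        (fun z => 8 * c * enorm (z.1 - y) `^ th + gg z.2)}.
      apply: continuous_subspaceT.
      apply: power_barrier_continuous; first exact: ltW.
      by move=> t; apply: differentiable_continuous; exact/derivable1_diffP.
    by move=> z; apply: cvgB; [exact: uc|exact: bc].
  have [[x2 t2]] := compact_EVT_max (ex_intro _ _ Kz1) Kc wcont.
  rewrite inE => Kz2 maxz2.
  (* By [powR_enormD], [8 * c * |x2 - y|^th] is at least
     [2 * c * |x2 - x1|^th - 8 * c * |y - x1|^th].  One copy of
     [c * |x2 - x1|^th] is used up by the local maximum of the unshifted
     barrier, the other one is the gain. *)
  have hz2 : (t2 - t1) ^+ 2 + c * enorm (x2 - x1) `^ th <=
      16 * c * enorm (y - x1) `^ th.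
    have := maxz2 (x1, t1); rewrite inE => /(_ Kz1).
    have [_ ] := hK _ Kz2; rewrite /w/= gg1 /M0 /gg.
    have := @powR_enormD _ _ th (x2 - y) (y - x1).
    rewrite addrA subrK => /(_ _)/(ler_wpM2l (ltW cp)).
    rewrite -(enormN (x1 - y)) opprB.
    rewrite (ltW th0) th2 => /(_ isT).
    move: (enorm (x2 - x1) `^ th) (enorm (x2 - y) `^ th) (enorm (y - x1) `^ th).
    move: (u (x2, t2)) (u (x1, t1)) (g t2) (g t1) ((t2 - t1) ^+ 2).
    by forget => *; lra.
  have t2d : `|t2 - t1| < d.
    rewrite -(@ltr_pXn2r _ 2) ?nnegrE ?(ltW d0)// real_normK ?num_real//.
    have : m <= d ^+ 2 by rewrite ge_min lexx.
    have := mulr_ge0 (ltW cp) (powR_ge0 (enorm (x2 - x1)) th).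
    move: hz2 ysm; move: (enorm (x2 - x1) `^ th) (enorm (y - x1) `^ th).
    by forget => *; lra.
  have x2r : enorm (x2 - x1) < rho.
    rewrite ltNge; apply/negP => h.
    have : rho `^ th <= enorm (x2 - x1) `^ th.
      by apply: ge0_ler_powR; rewrite ?nnegrE ?enorm_ge0 ?(ltW rho0) ?(ltW th0).
    move=> /(ler_wpM2l (ltW cp)).
    have : m <= c * rho `^ th by rewrite ge_min lexx orbT.
    have := sqr_ge0 (t2 - t1); move: hz2 ysm.
    move: (enorm (x2 - x1) `^ th) (enorm (y - x1) `^ th) (rho `^ th).
    by forget => *; lra.
  have x2y : x2 = y.
    apply/eqP; apply/negPn/negP => x2y.
    have Qz2 := (hK _ Kz2).1.
    have t2d' := t2d; rewrite ltr_norml in t2d'; have /andP[t2a t2b] := t2d'.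
    have lm2 : local_max
        (fun z => u z - (8 * c * enorm (z.1 - y) `^ th + gg z.2)) (x2, t2).
      apply: filterS (@nbhs_cylinder R n x1 rho (t1 - d) (t1 + d) (x2, t2) x2r _).
        move=> z [zr /andP[z1 z2]] _; apply: maxz2; rewrite inE.
        split => /=; first exact: ltW.
        by rewrite !ltW.
      by move: t2a t2b; forget => t2a t2b; apply/andP; split => /=; lra.
    have yK : K (y, t1).
      split; first exact: ltW.
      by move: d0; forget => d0; apply/andP; split => /=; lra.
    have c80 : 0 < 8 * c by rewrite mulr_gt0.
    have c81 : 8 * c <= 1 / 4 by move: c32; forget; lra.
    have := gc t2.
    have : 'D_1 g t2 + 2 * (t2 - t1) <=
        c0 + 2 * (8 * c) * (1 + A) * (n%:R + p - 2).
      have <- := congr1 (@^~ t2) ggE.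
      exact: (sub_test_away c80 c81
        (hK _ yK).1.1 dgg' cgg Qz2 x2y lm2).
    by move: t2a dc csmall; forget; lra.
  exists t2; split=> // z Kz.
  have := maxz2 z; rewrite inE => /(_ Kz).
  rewrite {2}/w x2y subrr enorm0 powR0 ?gt_eqF//=.
  by rewrite mulr0 add0r.
have [tt htt] : exists tt : 'rV[R]_n -> R, forall y, eball dl x1 y ->
    `|tt y - t1| < d /\ forall z, K z -> w y z <= u (y, tt y) - gg (tt y).
  have : forall y, exists t, eball dl x1 y -> `|t - t1| < d /\
      forall z, K z -> w y z <= u (y, t) - gg t.
    move=> y; have [/maxw[t [t2 ht]]|ny] := pselect (eball dl x1 y); first by exists t.
    by exists 0.
  by move=> /choice[tt htt]; exists tt.
pose M y := u (y, tt y) - gg (tt y).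
have Ktt y : eball dl x1 y -> K (y, tt y).
  move=> yd; have [+ _] := htt _ yd; rewrite ltr_norml => /andP[h1 h2].
  have [/ltW ? _] := hdl _ yd; split => //=.
  by move: h1 h2; forget => h1 h2; apply/andP; split; lra.
have Mle x y : eball dl x1 x -> eball dl x1 y ->
    M x - M y <= 8 * c * enorm (x - y) `^ th.
  move=> xd yd; have [_ /(_ _ (Ktt _ xd))] := htt _ yd.
  by rewrite /w/= /M; forget; lra.
have Mcst x : eball dl x1 x -> M x = M x1.
  apply: (@holder_gt1_constant _ _ M x1 dl (8 * c) th th1) => y z yd zd.
  have es : enorm (y - z) = enorm (z - y) by rewrite -enormN opprB.
  rewrite ler_norml (Mle _ _ yd zd) andbT es.
  by have := Mle _ _ zd yd; forget; lra.
have [_ _ /(_ x1 t1 Qz1)[_ test]] := usub.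
have wK x t : eball dl x1 x -> twindow x t1 d t -> K (x, t).
  move=> xd [/andP[h1 h2] _]; have [/ltW ? _] := hdl _ xd.
  by split => //=; rewrite !ltW.
have dphi (t : R) : is_derive t 1 (fun t => gg t - gg t1) ('D_1 g t + 2 * (t - t1)).
  have h := dgg t; have h2 := @is_derive_cst R _ _ (gg t1) t 1.
  by have := is_deriveB h h2; rewrite subr0.
have dphiE : 'D_1 (fun t => gg t - gg t1) = 'D_1 gg.
  by rewrite ggE; apply/funext => t; have h := dphi t; rewrite derive_val.
have x1d : eball dl x1 x1 by rewrite /eball/= subrr enorm0.
have h : 'D_1 (fun t => gg t - gg t1) t1 <= f (x1, t1).
  apply: (test d (fun t => gg t - gg t1) d0).
  - split; first by move=> t _; have [] := dphi t.
    by rewrite dphiE => t _; exact: cgg.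
  - by rewrite subrr.
  - move=> t /(wK _ _ x1d) /hK[_].
    rewrite /= subrr enorm0 powR0 ?gt_eqF//.
    rewrite gg1 /gg /M0; have := sqr_ge0 (t - t1); forget; lra.
  - exists (M x1 + gg t1)%:E.
    apply: filterS (nbhs_eball x1 dl0) => x xd.
    apply/eqP; rewrite eq_le; apply/andP; split.
      apply: ge_ereal_sup => _ [t tw <-]; rewrite lee_fin -(Mcst _ xd).
      have [_ /(_ _ (wK _ _ xd tw))] := htt _ xd.
      rewrite /w/= subrr enorm0 powR0 ?gt_eqF//.
      by rewrite /M; forget; lra.
    apply: ereal_sup_ubound; exists (tt x) => /=.
      split; last exact: (hK _ (Ktt _ xd)).1.
      have [+ _] := htt _ xd; rewrite ltr_norml; forget => /andP[? ?].
      by apply/andP; split; lra.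
    by rewrite -(Mcst _ xd) /M; congr (_%:E); ring.
have {}h : 'D_1 g t1 <= f (x1, t1).
  apply: le_trans h; rewrite (_ : 'D_1 g t1 = 'D_1 (fun t => gg t - gg t1) t1)//.
  by have e1 := dphi t1; rewrite derive_val subrr mulr0 addr0.
have := fc0 Qz1; have := gc t1; have np := dim_pos.
have : 0 <= 16 * c * (1 + A) * (n%:R + p - 2).
  apply: mulr_ge0 np; apply: mulr_ge0; last exact: addr_ge0.
  by rewrite ?mulr_ge0 ?(ltW cp).
by move: cp csmall h; forget; lra.
Qed.

Lemma sub_interior_max (c : R) (x0 x1 : 'rV[R]_n) (t1 : R) (g : R -> R) :
  0 < c -> 32 * c <= 1 ->
  2 * c + 16 * c * (1 + A) * (n%:R + p - 2) < - c0 ->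
  (forall t, derivable g t 1) -> continuous ('D_1 g) ->
  (forall t, - c <= 'D_1 g t) -> eball 1 0 x0 ->
  Q 1 (x1, t1) -> t1 < 0 ->
  ~ local_max (fun z => u z - (c * enorm (z.1 - x0) `^ th + g z.2)) (x1, t1).
Proof.
move=> cp c32 csm dg cg gc x01 Qz1 t10 lm.
have [x10|x10] := eqVneq x1 x0.
  move: lm; rewrite -x10.
  exact: (sub_test_center).
have c4 : c <= 1 / 4 by lra.
have h := sub_test_away cp c4 x01 dg cg Qz1 x10 lm.
have := le_trans (gc t1) h; have np := dim_pos.
have : 0 <= c * (1 + A) * (n%:R + p - 2).
  apply: mulr_ge0 np; apply: mulr_ge0; last exact: addr_ge0.
  by rewrite ?mulr_ge0 ?(ltW cp).
by move: cp csm; forget; lra.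
Qed.

(** With [L = r `^ th], the barrier exceeds [c * L] up to small errors on the whole
    parabolic boundary, where [u - u z0] is below [c * L / 2]; at the apex
    [(x0, t')] the barrier is at most [c * L / 16].  So [u] minus the barrier is
    larger at the apex than near the parabolic boundary, and a maximum is
    interior. *)
Lemma sub_boundary_growth (c r : R) (z0 : 'rV[R]_n * R) :
  0 < c -> 32 * c <= 1 ->
  2 * c + 16 * c * (1 + A) * (n%:R + p - 2) < - c0 ->
  Q 1 z0 -> 0 < r -> Qtheta r th z0 `<=` Q 1 ->
  ~ forall z, par_boundary r th z0 z -> (bval u z < (u z0 + c / 2 * r `^ th)%:E)%E.
Proof.
case: z0 => x0 t0 cp c32 csm Qz0 r0 QQ; set L := r `^ th => hb.
have /andP[th1 th2] := th_bounds; have th0 : 0 < th := lt_trans ltr01 th1.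
have L0 : 0 < L by rewrite powR_gt0.
have cL0 : 0 < c * L by rewrite mulr_gt0.
have t00 : t0 <= 0 by have [_ /andP[]] := Qz0.
have QE x t : enorm (x - x0) < r -> t0 - L < t -> t <= t0 -> Q 1 (x, t).
  by move=> xr t1 t2; apply: QQ; split => //; apply/andP.
(* The apex is moved to the earlier time [t0 - 2 * sg], where [u] is almost
   [u (x0, t0)], to leave room for the maximum before the final time. *)
have [e e0 he] : exists2 e, 0 < e &
  forall y s, enorm (y - x0) < e -> `|s - t0| < e ->
    Q 1 (y, s) -> u (x0, t0) - c * L / 16 < u (y, s).
  have : \forall z \near within (Q 1) (nbhs (x0, t0)),
      u (x0, t0) - c * L / 16 < u z.
    have /subspace_continuousP/(_ _ Qz0)/cvgr_gt := cu.
    by apply; rewrite ltrBlDr ltrDl divr_gt0.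
  by move=> /nbhs_box[e e0 he]; exists e.
pose sg := Num.min (e / 4) (L / 64).
have sg0 : 0 < sg by rewrite lt_min !divr_gt0.
have sge : sg <= e / 4 by rewrite ge_min lexx.
have sgL : sg <= L / 64 by rewrite ge_min lexx orbT.
have csgL : c * sg <= c * L / 64 by rewrite -mulrA ler_pM2l.
pose t' := t0 - 2 * sg; pose T := t0 - sg.
pose E : set ('rV[R]_n * R) := [set z | enorm (z.1 - x0) < r /\ t0 - L < z.2 <= T].
pose K := [set x | enorm (x - x0) <= r] `*` [set t | t0 - L <= t <= T].
have EQ z : E z -> Q 1 z.
  by case: z => x t [/= xr /andP[t1 t2]]; apply: QE => //; move: t2 sg0;
    rewrite /T; forget; lra.
have EK : E `<=` K.
  by move=> z [zr /andP[z1 z2]]; split; [exact: ltW|apply/andP; split => //; exact: ltW].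
have Kc : compact K by exact: compact_cylinder.
have KE z : K z -> E z \/ par_boundary r th (x0, t0) z.
  case: z => x t [/= xr /andP[t1 t2]].
  have tt0 : t < t0 by move: t2 sg0; rewrite /T; forget; lra.
  move: xr; rewrite le_eqVlt => /predU1P[xr|xr].
    by right; left; split => //=; rewrite t1.
  move: t1; rewrite le_eqVlt => /predU1P[t1|t1]; first by right; right; split => //=.
  by left; split => //=; rewrite t1.
have E' : E (x0, t').
  split => /=; first by rewrite subrr enorm0.
  rewrite /t' /T; move: L0 sg0 sgL; forget => L0 sg0 sgL.
  by apply/andP; split; lra.
have u' : u (x0, t0) - c * L / 16 < u (x0, t').
  apply: he; [by rewrite subrr enorm0| |exact: EQ].
  rewrite /t' ltr_norml; move: e0 sg0 sge; forget => e0 sg0 sge.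
  by apply/andP; split; lra.
(* [u] is bounded above on [E] since its upper limits are finite on the compact
   set [K], including the part of [K] on the boundary of the domain. *)
have [Bd hBd] : exists Bd, forall z, E z -> u z <= Bd.
  have [q Kq hq] := compact_sup_point u Kc EK (ex_intro _ _ E').
  have [m /bval_lt mq] : exists m : R, (bval u q < m%:E)%E.
    have [Eq|/hb bq] := KE _ Kq; last by eexists; exact: bq.
    by exists (u q + 1); rewrite bvalE ?lte_fin ?ltrDl//; exact: EQ.
  exists m => z Ez; rewrite leNgt; apply/negP => mz.
  have [|v [Ev /(_ (EQ _ Ev)) vm] mv] := hq _ m mq; first by exists z.
  by move: vm; rewrite ltNge (ltW mv).
(* At time [T] the function [u - c * (t' - t)] exceeds [m0] by at most [X].  As
   [expR (N * sg) >= 1 + N * sg], the exponential term is then larger than [X]. *)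
pose m0 := u (x0, t0) - c * L / 8.
pose ka := c * L / 16; have ka0 : 0 < ka by rewrite divr_gt0.
pose X := Bd + c * sg - m0.
pose N := `|X| / (ka * sg).
have N0 : 0 <= N by rewrite divr_ge0// mulr_ge0// ltW.
pose g (t : R) : R := c * (t' - t) + ka * expR (N * (t - t')).
have dg (t : R) : is_derive t 1 g (- c + ka * (N * expR (N * (t - t')))).
  have d1 : is_derive t 1 (fun t => c * (t' - t)) (- c).
    by apply: (is_derive_quadratic (m := 0)) => h; rewrite /GRing.scale/=; ring.
  have d2 : is_derive t 1 (fun t => N * (t - t')) N.
    by apply: (is_derive_quadratic (m := 0)) => h; rewrite /GRing.scale/=; ring.
  have d3 := @is_derive1_comp R expR (fun t => N * (t - t')) t _ _
    (is_derive_expR _) d2.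
  have d4 := is_deriveD d1 (is_deriveZ ka d3).
  by apply: is_derive_eq d4 _; rewrite /GRing.scale/=; ring.
have gE : 'D_1 g = fun t => - c + ka * (N * expR (N * (t - t'))).
  by apply/funext => t; have h := dg t; rewrite derive_val.
have dg' (t : R) : derivable g t 1 by have [] := dg t.
have cdg : continuous ('D_1 g).
  rewrite gE => t; apply: cvgD; first exact: cvg_cst.
  apply: cvgMr; apply: cvgMr.
  apply: (@continuous_comp _ _ _ (fun t => N * (t - t')) expR);
    last exact: continuous_expR.
  apply: cvgMr; apply: (@continuousB _ _ _ id (cst t')); first exact: cvg_id.
  exact: cst_continuous.
have gc (t : R) : - c <= 'D_1 g t.
  have := congr1 (@^~ t) gE; rewrite /= => ->.
  by rewrite lerDl; exact: mulr_ge0 (ltW ka0) (mulr_ge0 N0 (expR_ge0 _)).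
have cg : continuous g.
  by move=> t; apply: differentiable_continuous; exact/derivable1_diffP.
pose bar (z : 'rV[R]_n * R) := c * enorm (z.1 - x0) `^ th + g z.2.
have cbar : continuous bar.
  by apply: power_barrier_continuous => //; exact: ltW.
pose w z := u z - bar z.
have w' : m0 < w (x0, t').
  rewrite /w /bar /g /= subrr enorm0 powR0 ?gt_eqF//.
  rewrite !subrr !mulr0 expR0 mulr1 !add0r /m0 /ka.
  by move: u'; forget; lra.
have wq q : Q 1 q -> (fun z => w z) @ within (Q 1) (nbhs q) --> w q.
  move=> Qq; apply: cvgB.
    by have /subspace_continuousP := cu; apply.
  by apply: cvg_within_filter; exact: cbar.
have [q Kq hq] := compact_sup_point w Kc EK (ex_intro _ _ E').
have gge t : c * (t' - t) <= g t.
  by rewrite lerDl; exact: mulr_ge0 (ltW ka0) (expR_ge0 _).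
have Eq : E q.
  have [//|bq] := KE _ Kq; exfalso.
  have barq : c * L - c * L / 32 <= bar q.
    case: q {hq} Kq bq => x t [/= xr /andP[t1 t2]] [[/= xr' _]|[/= _ tE]].
      rewrite /bar/= xr' -/L; apply: le_trans (lerD (lexx _) (gge t)).
      have : c * (- sg) <= c * (t' - t).
        by rewrite ler_pM2l// /t'; move: t2; rewrite /T; forget; lra.
      by move: csgL cL0; forget; lra.
    rewrite /bar/=; have := gge t; rewrite tE -/L /t'.
    have := mulr_ge0 (ltW cp) (powR_ge0 (enorm (x - x0)) th).
    by move: csgL cL0; forget; lra.
  have n1 : \forall z \near q, Q 1 z -> u z < u (x0, t0) + c / 2 * L.
    by apply: bval_lt; exact: hb.
  have n2 : \forall z \near q, bar q - c * L / 32 < bar z.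
    have /cvgr_gt := cbar q; apply; rewrite ltrBlDr ltrDl.
    by rewrite divr_gt0.
  have [|v [Ev [/(_ (EQ _ Ev)) v1 v2]] mv] := hq _ m0 (filterI n1 n2).
    by exists (x0, t').
  by move: mv v1 v2 barq cL0; rewrite /w /m0; forget; lra.
have Qq := EQ _ Eq.
have qmax z : E z -> w z <= w q.
  move=> Ez; rewrite leNgt; apply/negP => qz.
  pose m := (w q + w z) / 2.
  have n1 : \forall v \near within (Q 1) (nbhs q), w v < m.
    have /cvgr_lt := wq _ Qq; apply; rewrite /m.
    by move: qz; forget; lra.
  have [|v [Ev /(_ (EQ _ Ev)) v1] mv] := hq _ m n1.
    by exists z => //; rewrite /m; move: qz; forget; lra.
  by move: v1 mv; forget; lra.
have wqm : m0 < w q by apply: lt_le_trans w' _; exact: qmax.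
have qT : q.2 < T.
  have [_ /andP[_]] := Eq; rewrite le_eqVlt => /predU1P[qT|//]; exfalso.
  have := hBd _ Eq => uB.
  move: wqm; rewrite /w /bar /g qT.
  have -> : T - t' = sg by rewrite /T /t'; ring.
  have -> : t' - T = - sg by rewrite /T /t'; ring.
  have := mulr_ge0 (ltW cp) (powR_ge0 (enorm (q.1 - x0)) th).
  have : ka * (1 + N * sg) <= ka * expR (N * sg) by rewrite ler_pM2l// expR_ge1Dx.
  have -> : ka * (1 + N * sg) = ka + `|X|.
    by rewrite /N; field; rewrite !gt_eqF.
  by have := ler_norm X; rewrite /X; move: uB ka0; forget; lra.
case: q Kq hq Eq Qq qmax wqm qT => x1 t1 _ _ [/= x1r /andP[t1b _]] Qz1 qmax _ /= t1T.
apply: (@sub_interior_max c x0 x1 t1 g) => //.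
- by have [] := Qz0.
- by move: t1T t00 sg0; rewrite /T; forget; lra.
apply: filterS (@nbhs_cylinder R n x0 r (t0 - L) T (x1, t1) x1r _).
  by move=> z [zr /andP[z1 z2]] _; apply: qmax; split => //; rewrite z1 ltW.
by apply/andP.
Qed.

End barrier.

Theorem theorem1p3 (R : realType) (n : nat) (p pp qq A c0 : R) :
  (0 < n)%N -> 1 < p -> 0 <= pp -> pp <= qq -> c0 < 0 ->
  exists2 C : R, 0 < C &
    forall a f u : 'rV[R]_n * R -> R,
      (0 < ereal_inf [set (a z)%:E | z in Q 1])%E ->
      (ereal_sup [set (a z)%:E | z in Q 1] < +oo)%E ->
      is_C1 a ->
      (Linfty_norm (Q 1) (grad_xt_norm a) < +oo)%E ->
      Linfty_norm (Q 1) a = A%:E ->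
      {within Q 1, continuous f} ->
      (Linfty_norm (Q 1) f < +oo)%E ->
      (ereal_sup [set (f z)%:E | z in Q 1] <= c0%:E)%E ->
      viscosity_solution p pp qq a f u ->
      let theta := (2 + pp) / (1 + pp) in
      forall z0 : 'rV[R]_n * R, Q 1 z0 ->
        local_max u z0 \/ local_min u z0 ->
        forall r : R, 0 < r -> Qtheta r theta z0 `<=` Q 1 ->
          ((C * r `^ (1 + 1 / (1 + pp)))%:E <=
            ereal_sup [set bval u z - (u z0)%:E | z in par_boundary r theta z0])%E.
Proof.
move=> n0 p1 pp0 ppqq c00.
have np : 0 <= n%:R + p - 2.
  by have : (1 : R) <= n%:R by [rewrite ler1n]; lra.
pose B := 2 + 16 * (1 + `|A|) * (n%:R + p - 2).
have B0 : 0 < B by rewrite ltr_pwDl// !mulr_ge0// addr_ge0.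
pose c := Num.min (1 / 32) (- c0 / (2 * B)).
have cp : 0 < c by rewrite lt_min !divr_gt0 ?mulr_gt0//; lra.
have c32 : 32 * c <= 1.
  have : c <= 1 / 32 by rewrite ge_min lexx.
  lra.
have csm : 2 * c + 16 * c * (1 + `|A|) * (n%:R + p - 2) < - c0.
  have : c <= - c0 / (2 * B) by rewrite ge_min lexx orbT.
  rewrite ler_pdivlMr ?mulr_gt0// /B; lra.
(* The factor 1/32 keeps gradients at most 1, also after [c] has been multiplied
   by 8 at the tip; the other bound makes the terms of order [c] smaller than
   [- c0]. *)
exists (c / 2); first by rewrite divr_gt0.
move=> a f u _ _ _ _ aA _ _ fc [cu usub _] theta z0 Qz0 _ r r0 QQ.
have aA' z : Q 1 z -> a z <= `|A|.
  move=> Qz; apply: le_trans (ler_norm A); rewrite -lee_fin -aA.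
  apply: le_trans (_ : `|a z|%:E <= _)%E; first by rewrite lee_fin ler_norm.
  by apply: ereal_sup_ubound; exists z.
have fc0 z : Q 1 z -> f z <= c0.
  move=> Qz; rewrite -lee_fin; apply: le_trans fc.
  by apply: ereal_sup_ubound; exists z.
rewrite (_ : 1 + 1 / (1 + pp) = theta); last by rewrite /theta; field; lra.
rewrite leNgt; apply/negP => hlt.
have := @sub_boundary_growth R n p pp qq theta `|A| c0 n0 p1 pp0 ppqq erefl
  a f u (normr_ge0 _) aA' fc0 usub cu c r z0 cp c32 csm Qz0 r0 QQ.
apply=> z bz; rewrite addrC EFinD -lteBlDr//; apply: le_lt_trans hlt.
by apply: ereal_sup_ubound; exists z.
Qed.
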